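(* Fix $d>0$. Then the ball (of diameter $d$) is a solution of the maximization problem $$\sup \Big\{\mu_1(\Omega) : \Omega \in \mathcal{K}_N,\ \mathrm{diam}(\Omega)=d \Big\},$$ that is, the supremum is attained at the open ball of radius $d/2$ in $\mathbb{R}^N$.
   Context: $\mathcal{K}_N$ denotes the collection of all open, bounded and convex subsets $\Omega\subset\mathbb{R}^N$, and $\mathrm{diam}(\Omega)=\sup\{|x-y| : x,y\in\Omega\}$. For a symmetric $N\times N$ matrix $X$, $\lambda_1(X)\le \dots\le \lambda_N(X)$ denote its ordered eigenvalues, so $\lambda_N(X)$ is the largest one. For an open, bounded, nonempty set $\Omega\subset\mathbb{R}^N$, the principal eigenvalue of the operator $-\lambda_N(D^2 u)$ with Dirichlet boundary conditions is defined by $$\mu_1(\Omega) := \sup \{ \mu \in \mathbb{R} : \exists\, \varphi \in LSC(\Omega),\ \varphi > 0 \text{ in }\Omega, \text{ such that } -\lambda_N(D^2 \varphi) \geq \mu \varphi \text{ in } \Omega\},$$ where $LSC(\Omega)$ is the set of lower semicontinuous real functions on $\Omega$ and the inequality is understood in the viscosity sense: for every $x_0\in\Omega$ and every $C^2$ function $\psi$ defined near $x_0$ such that $\varphi-\psi$ has a local minimum at $x_0$ with $\varphi(x_0)=\psi(x_0)$, one has $-\lambda_N(D^2\psi(x_0))\ge \mu\,\varphi(x_0)$. *)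

(* Defs.v *)
From HB Require Import structures.
From mathcomp Require Import all_boot all_order all_algebra.
From mathcomp Require Import all_classical all_reals all_analysis.
Import Order.TTheory GRing.Theory Num.Theory.
Import numFieldNormedType.Exports.

Set Implicit Arguments.
Unset Strict Implicit.
Unset Printing Implicit Defensive.

Local Open Scope classical_set_scope.
Local Open Scope ring_scope.

(* The library norm on 'rV[R]_N is the sup norm. It induces the right topology
   and the right bounded sets, but diameters and balls have to be Euclidean. *)
Definition enorm (R : realType) (N : nat) (x : 'rV[R]_N) : R :=
  Num.sqrt (\sum_(i < N) x 0 i ^+ 2).

Definition eball (R : realType) (N : nat) (c : 'rV[R]_N) (r : R) :
  set 'rV[R]_N := [set x | enorm (x - c) < r].

Definition diam (R : realType) (N : nat) (Omega : set 'rV[R]_N) : R :=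
  sup [set enorm (p.1 - p.2) | p in Omega `*` Omega].

Definition open_bounded_convex (R : realType) (N : nat) :
    set (set 'rV[R]_N) :=
  [set Omega | [/\ open Omega, bounded_set Omega & convex_set Omega]].

Definition partial (R : realType) (N : nat) (i : 'I_N) (f : 'rV[R]_N -> R) :
  'rV[R]_N -> R := fun x => 'D_(delta_mx 0 i) f x.

Definition C2_at (R : realType) (N : nat) (f : 'rV[R]_N -> R) (x0 : 'rV[R]_N) :
    Prop :=
  \forall x \near x0, forall i j : 'I_N,
    [/\ derivable f x (delta_mx 0 i),
        {for x, continuous (partial i f)},
        derivable (partial i f) x (delta_mx 0 j) &
        {for x, continuous (partial j (partial i f))}].

Definition hessian (R : realType) (N : nat) (f : 'rV[R]_N -> R)
    (x : 'rV[R]_N) : 'M[R]_N :=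
  \matrix_(i < N, j < N) partial j (partial i f) x.

(* For 0 < N and X symmetric the set of eigenvalues is finite and nonempty, so
   that this supremum is the largest eigenvalue lambda_N(X). *)
Definition lambda_max (R : realType) (N : nat) (X : 'M[R]_N) : R :=
  sup [set a : R | eigenvalue X a].

(* -lambda_N(D^2 phi) >= mu * phi in Omega, in the viscosity sense. The values
   of phi outside Omega and of psi away from x0 are irrelevant. *)
Definition viscosity_supersolution (R : realType) (N : nat)
    (Omega : set 'rV[R]_N) (mu : R) (phi : 'rV[R]_N -> R) : Prop :=
  forall (x0 : 'rV[R]_N) (psi : 'rV[R]_N -> R),
    Omega x0 -> C2_at psi x0 ->
    (\forall x \near x0, Omega x -> phi x0 - psi x0 <= phi x - psi x) ->
    phi x0 = psi x0 ->
    mu * phi x0 <= - lambda_max (hessian psi x0).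

(* [subspace Omega] carries the topology for which semicontinuity is tested
   only at points of Omega and along points of Omega. *)
Definition lsc_on (R : realType) (N : nat) (Omega : set 'rV[R]_N)
    (phi : 'rV[R]_N -> R) : Prop :=
  lower_semicontinuous (fun x : subspace Omega => (phi x)%:E).

Definition mu1 (R : realType) (N : nat) (Omega : set 'rV[R]_N) : \bar R :=
  ereal_sup [set mu%:E | mu in [set mu : R |
    exists phi : 'rV[R]_N -> R,
      [/\ lsc_on Omega phi,
          (forall x, Omega x -> 0 < phi x) &
          viscosity_supersolution Omega mu phi]]].

(* Main.v *)
Require Import Defs.
From HB Require Import structures.
From mathcomp Require Import all_boot all_order all_algebra.
From mathcomp Require Import all_classical all_reals all_analysis.
From mathcomp Require Import ring lra.
Import Order.TTheory GRing.Theory Num.Theory.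
Import numFieldNormedType.Exports.

Local Open Scope classical_set_scope.
Local Open Scope ring_scope.

(** Both sides of the maximization problem are equal to (pi / d)^2.

    Upper bound ([supersolution_le_diam]). The inequality
    - lambda_N(D^2 phi) >= mu phi bounds every second directional derivative of
    phi by - mu phi, so along a segment of length L inside Omega the positive
    function phi is a one-dimensional supersolution of - phi'' >= mu phi, which
    forces mu <= (pi / L)^2. As Omega is convex, L may be taken as close to its
    diameter as desired. In the viscosity sense the one-dimensional argument is
    run on a thin cylinder around the segment ([supersolution_le_segment]): a
    multiple of sin (pi s / L) (r^2 - |y|^2), where s is the coordinate along
    the segment and y the transversal displacement, touches phi from below at
    an interior point ([touch_from_below]). This test function is an exact
    eigenfunction in the direction of the segment, whatever y is, and comparing
    with mu phi at the contact point gives the bound.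

    Lower bound ([ball_supersolution]). On the ball of diameter d and centre c,
    phi(x) = cos (k |x - c|) with k = pi / d is a positive supersolution for
    mu = k^2. Rather than the Hessian of phi, which is awkward at the centre,
    the proof uses the inequality
      cos |X + H| + cos |X - H| <= 2 cos |X| cos |H|
    ([cos_enorm_midpoint]), which follows from the parallelogram identity and
    the convexity of t |-> cos (sqrt t) on [0, pi^2], that is, from the
    monotonicity of sin s / s. If psi touches phi from below at x0, then psi
    satisfies the same inequality at x0, and its second order expansion gives
    D^2 psi(x0)(v, v) <= - k^2 phi(x0) |v|^2 for every v.

    Both halves read the Hessian of a C^2 test function off symmetric second
    differences ([hessian_cos_test]), and use that the supremum defining
    [lambda_max] is the maximum of the Rayleigh quotient ([lambda_max_ge],
    [lambda_max_le]). The latter needs the Hessian to be symmetric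
    ([hessian_sym]): otherwise the set of real eigenvalues could be empty and
    its supremum meaningless. *)

(** * Derivatives along lines *)

Section lines.
Context {R : realType} {V : normedModType R}.
Implicit Types (f : V -> R) (p v x : V).

(** The two difference quotients are the same function of the increment. *)
Lemma is_derive_lineP f p v s (l : R) :
  is_derive s (1 : R) (fun h : R => f (p + h *: v)) l <->
  is_derive (p + s *: v) v f l.
Proof.
have E : (fun h : R => h^-1 *: (f (p + (h *: (1 : R) + s) *: v)
                                - f (p + s *: v))) =
         (fun h : R => h^-1 *: (f (h *: v + (p + s *: v)) - f (p + s *: v))).
  apply/funext => h; congr (_ *: (f _ - _)).
  by rewrite scalerDl [h *: 1]mulr1 addrCA.
split=> -[df <-]; apply: DeriveDef; move: df; rewrite /derivable /derive /=.
- by rewrite E.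
- by rewrite E.
- by rewrite -E.
- by rewrite -E.
Qed.

Lemma is_derive_line f p v s : derivable f (p + s *: v) v ->
  is_derive s (1 : R) (fun h : R => f (p + h *: v)) ('D_v f (p + s *: v)).
Proof. by move=> df; apply/is_derive_lineP; exact: derivableP. Qed.

(** The mean value theorem in a form that treats both signs of the increment
    [h] at once. *)
Lemma line_MVT f p v h :
  (forall s, `|s| <= `|h| -> derivable f (p + s *: v) v) ->
  exists2 s, `|s| <= `|h| &
    f (p + h *: v) - f p = h * 'D_v f (p + s *: v).
Proof.
move=> df.
have [h0|h0] := leP 0 h.
- have D s : s \in `[0, h] -> is_derive s (1 : R) (fun h : R => f (p + h *: v))
       ('D_v f (p + s *: v)).
    rewrite in_itv/= => /andP[s0 sh]; apply: is_derive_line; apply: df.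
    by rewrite !ger0_norm.
  have [|c] := MVT_segment h0 (fun s sI => D s (subset_itv_oo_cc sI)).
    apply: derivable_within_continuous => s /D Ds; exact: ex_derive.
  rewrite in_itv/= scale0r addr0 subr0 => /andP[c0 ch] ->.
  by exists c; rewrite 1?mulrC// !ger0_norm.
- have D s : s \in `[h, 0] -> is_derive s (1 : R) (fun h : R => f (p + h *: v))
       ('D_v f (p + s *: v)).
    rewrite in_itv/= => /andP[s0 sh]; apply: is_derive_line; apply: df.
    by rewrite (ler0_norm sh) (ltr0_norm h0) lerN2.
  have [|c] := MVT_segment (ltW h0) (fun s sI => D s (subset_itv_oo_cc sI)).
    apply: derivable_within_continuous => s /D Ds; exact: ex_derive.
  rewrite in_itv/= scale0r addr0 sub0r => /andP[c0 ch] E.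
  exists c; first by rewrite (ler0_norm ch) (ltr0_norm h0) lerN2.
  by apply: oppr_inj; rewrite opprB E mulrN mulrC.
Qed.

Lemma is_derive_cvg f x v (l : R) :
  h^-1 *: (f (h *: v + x) - f x) @[h --> (0 : R)^'] --> l -> is_derive x v f l.
Proof. by move=> fl; apply: DeriveDef; [exact: cvgP fl|exact: cvg_lim fl]. Qed.

(** One step of the passage from partial to total derivatives: the increment of
    [f] along [w + a *: v] is the increment along [w], handled by the derivative
    already known, plus an increment along [v] starting at a nearby point, which
    the mean value theorem and the continuity of the [v]-derivative control. *)
Lemma is_derive_addZ f x w v a A :
  (\forall y \near x, derivable f y v) ->
  {for x, continuous (fun y => 'D_v f y)} ->
  is_derive x w f A ->
  is_derive x (w + a *: v) f (A + a * 'D_v f x).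
Proof.
move=> df cf [dw <-]; apply: is_derive_cvg.
rewrite (_ : (fun h => _) = (fun h => h^-1 *: (f (h *: w + x) - f x)
    + h^-1 *: (f (h *: (w + a *: v) + x) - f (h *: w + x)))); last first.
  by apply/funext => h; rewrite -scalerDr [X in _ = _ *: X]addrC subrKA.
apply: cvgD; first exact: dw.
apply/cvgrPdist_le => eps eps0.
(* The [+ 1] here and in [K] only guards against a zero denominator. *)
have e1 : 0 < eps / (`|a| + 1) by rewrite divr_gt0// ltr_wpDl.
have /cvgrPdist_le /(_ _ e1) cfx := cf.
have : \forall y \near x, derivable f y v /\
    `|'D_v f x - 'D_v f y| <= eps / (`|a| + 1) by exact: filterI.
move=> /nbhs_ballP[del /= del0 B].
set K := `|w| + `|a| * `|v| + 1.
have K0 : 0 < K by rewrite ltr_wpDl// addr_ge0// mulr_ge0.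
have dK : 0 < del / K by rewrite divr_gt0.
near=> h.
have h0 : h != 0 by near: h; exact: nbhs_dnbhs_neq.
have hK : `|h| < del / K.
  near: h; apply: nbhs_dnbhs; apply/nbhs_ballP; exists (del / K) => //= h.
  by rewrite -ball_normE/= sub0r normrN.
have inB s : `|s| <= `|h * a| -> ball x del (h *: w + x + s *: v).
  move=> sle; rewrite -ball_normE /= distrC addrAC addrK.
  rewrite (le_lt_trans (ler_normD _ _))// !normrZ.
  rewrite (@le_lt_trans _ _ (`|h| * K))//; last by rewrite -ltr_pdivlMr.
  rewrite (@le_trans _ _ (`|h| * `|w| + (`|h| * `|a|) * `|v|))//.
    by rewrite lerD2l ler_wpM2r// -normrM.
  by rewrite /K !mulrDr mulrA mulr1 lerDl.
have [|s sle E] := @line_MVT f (h *: w + x) v (h * a).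
  by move=> s /inB /B[].
have -> : h *: (w + a *: v) + x = h *: w + x + (h * a) *: v.
  by rewrite scalerDr scalerA addrAC.
have Q (D : R) : h^-1 *: (h * a * D) = a * D.
  by rewrite -[LHS]/(h^-1 * _) !mulrA mulVf// mul1r.
rewrite E Q -mulrBr normrM.
have [_ /= cle] := B _ (inB _ sle).
rewrite (le_trans (ler_wpM2l _ cle))// mulrCA ler_piMr ?(ltW eps0)//.
by rewrite ler_pdivrMr ?mul1r ?lerDl// ltr_wpDl.
Unshelve. all: by end_near. Qed.

Lemma is_derive_comp_real f x v a (g : R -> R) b :
  is_derive x v f a -> is_derive (f x) (1 : R) g b ->
  is_derive x v (fun y => g (f y)) (b * a).
Proof.
have {1 2 3}-> : x = x + 0 *: v by rewrite scale0r addr0.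
move=> /is_derive_lineP df dg; apply/is_derive_lineP.
exact: (@is_derive1_comp _ g (fun h => f (x + h *: v))).
Qed.

End lines.

Section partials.
Context {R : realType} {N : nat}.
Implicit Types (f : 'rV[R]_N -> R) (x v : 'rV[R]_N).

(** Coordinates of [v] are added one at a time by [is_derive_addZ]. *)
Lemma is_derive_partial f x v :
  (forall i, \forall y \near x, derivable f y (delta_mx 0 i)) ->
  (forall i, {for x, continuous (partial i f)}) ->
  is_derive x v f (\sum_i v 0 i * partial i f x).
Proof.
move=> df cf; rewrite [v in is_derive _ v]row_sum_delta.
elim: (index_enum _) => [|i s IH]; first by rewrite !big_nil; exact: is_derive0.
rewrite !big_cons (addrC (_ *: _)) (addrC (_ * _)).
exact: is_derive_addZ (v 0 i) _ (df i) (cf i) IH.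
Qed.

End partials.

(** * Second differences and the Hessian *)

Section second_difference.
Context {R : realType}.

(** If [A < 0], then [g'] is strictly smaller at [s] than at [- s] for small
    [s > 0], so [g s + g (- s)] decreases from its value [2 * g 0] at [s = 0]. *)
Lemma second_difference_test (g g' : R -> R) (A : R) :
  (\forall t \near 0, is_derive t (1 : R) g (g' t)) ->
  is_derive (0 : R) (1 : R) g' A ->
  (\forall t \near 0, 2 * g 0 <= g t + g (- t)) -> 0 <= A.
Proof.
move=> dg [dg' EA] gge; rewrite leNgt; apply/negP => A0.
have g'A : h^-1 * (g' h - g' 0) @[h --> (0 : R)^'] --> A.
  rewrite -EA /derive.
  rewrite [X in X @ _ --> _](_ : _ =
    (fun h => h^-1 *: (g' (h *: (1 : R) + 0) - g' 0))); first exact: dg'.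
  by apply/funext => h; rewrite [h *: 1]mulr1 addr0.
have : \forall h \near 0, h != 0 -> h^-1 * (g' h - g' 0) < 0.
  have /cvgrPdist_lt /(_ (- A)) := g'A; rewrite oppr_gt0 => /(_ A0).
  move=> /nbhs_ballP[e /= e0 B]; apply/nbhs_ballP; exists e => //= h he hn0.
  by have := B h he hn0; rewrite /= ltr_norml; lra.
move=> g'0; have /nbhs_ballP[e /= e0 B] : \forall t \near (0:R),
    [/\ is_derive t (1 : R) g (g' t), 2 * g 0 <= g t + g (- t) &
    t != 0 -> t^-1 * (g' t - g' 0) < 0].
  near=> t; split; near: t; [exact: dg|exact: gge|exact: g'0].
have {}B s : - e < s < e -> [/\ is_derive s (1 : R) g (g' s),
    2 * g 0 <= g s + g (- s) & s != 0 -> s^-1 * (g' s - g' 0) < 0].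
  by move=> se; apply: B; rewrite -ball_normE/= sub0r normrN ltr_norml.
set t := e / 2.
have [t0 te] : 0 < t /\ t < e by rewrite /t; lra.
have dG s : s \in `[0, t] ->
    is_derive s (1:R) (fun s => g s + g (- s)) (g' s - g' (- s)).
  rewrite in_itv/= => /andP[s0 st].
  have [|D1 _ _] := B s; first lra.
  have [|D2 _ _] := B (- s); first lra.
  have D3 : is_derive s (1:R) (fun s => g (- s)) (- g' (- s)).
    rewrite -mulrN1; apply: (@is_derive1_comp _ g (-%R)).
  exact: is_deriveD.
have [|c] := MVT t0 (fun s sI => dG s (subset_itv_oo_cc sI)).
  by apply: derivable_within_continuous => s /dG Ds; exact: ex_derive.
rewrite in_itv/= => /andP[c0 ct].
have [|_ tge _] := B t; first lra.
have [|_ _ /(_ _)] := B c; first lra.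
  rewrite gt_eqF// => /(_ isT).
rewrite pmulr_rlt0 ?invr_gt0// => Pc.
have [|_ _ /(_ _)] := B (- c); first lra.
rewrite oppr_eq0 gt_eqF// => /(_ isT).
rewrite invrN mulNr oppr_lt0 pmulr_rgt0 ?invr_gt0// => Pnc.
rewrite oppr0 addr0 => E.
have : (g' c - g' (- c)) * t < 0 by rewrite pmulr_llt0//; lra.
by rewrite -E; lra.
Unshelve. all: by end_near. Qed.

End second_difference.

Section C2.
Context {R : realType} {N : nat}.
Implicit Types (f : 'rV[R]_N -> R) (x v : 'rV[R]_N).

Lemma C2_at_self f x : C2_at f x -> forall i j : 'I_N,
  [/\ derivable f x (delta_mx 0 i), {for x, continuous (partial i f)},
      derivable (partial i f) x (delta_mx 0 j) &
      {for x, continuous (partial j (partial i f))}].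
Proof. by move=> fC; exact: (@nbhs_singleton _ x _ fC). Qed.

Lemma C2_at_is_derive f x v :
  C2_at f x -> is_derive x v f (\sum_i v 0 i * partial i f x).
Proof.
move=> fC; apply: is_derive_partial => i.
- by apply: filterS fC => y /(_ i i)[].
- by have [] := C2_at_self f x fC i i.
Qed.

Lemma C2_at_is_derive_partial f x v i : C2_at f x ->
  is_derive x v (partial i f) (\sum_j v 0 j * partial j (partial i f) x).
Proof.
move=> fC; apply: is_derive_partial => j.
- by apply: filterS fC => y /(_ i j)[].
- by have [] := C2_at_self f x fC i j.
Qed.

(** The mean value theorem is applied to the increment of [f] along [e_j] as a
    function of the coordinate [i], then to [partial i f] along [e_j]. Up to a
    reordering of terms the left-hand side is symmetric in [i] and [j], whereas
    the right-hand side shows one of the two mixed derivatives. *)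
Lemma mixed_difference f x i j (del t : R) :
  (forall y, ball x del y -> derivable f y (delta_mx 0 i) /\
     derivable (partial i f) y (delta_mx 0 j)) ->
  `|t| * (`|delta_mx 0 i : 'rV[R]_N| + `|delta_mx 0 j : 'rV[R]_N|) < del ->
  exists2 y, ball x del y &
    f (x + t *: delta_mx 0 i + t *: delta_mx 0 j) - f (x + t *: delta_mx 0 i)
    - (f (x + t *: delta_mx 0 j) - f x) = t * (t * partial j (partial i f) y).
Proof.
set ei := delta_mx 0 i; set ej := delta_mx 0 j => df tdel.
have inB s r : `|s| <= `|t| -> `|r| <= `|t| ->
    ball x del (x + s *: ei + r *: ej).
  move=> sle rle; rewrite -ball_normE/= -addrA opprD addNKr normrN.
  rewrite (le_lt_trans (ler_normD _ _))// !normrZ.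
  by rewrite (le_lt_trans _ tdel)// mulrDr lerD// ler_wpM2r.
have t0 : `|0 : R| <= `|t| by rewrite normr0.
pose F y := f (y + t *: ej) - f y.
have dF s : `|s| <= `|t| -> is_derive (x + s *: ei) ei F
    (partial i f (x + s *: ei + t *: ej) - partial i f (x + s *: ei)).
  move=> sle; have [d1 _] := df _ (inB _ _ sle (lexx _)).
  have [d2 _] := df _ (inB _ _ sle t0); rewrite scale0r addr0 in d2.
  suff d3 : is_derive (x + s *: ei) ei (fun y => f (y + t *: ej))
      (partial i f (x + s *: ei + t *: ej)).
    by have := derivableP d2; exact: is_deriveB.
  have E : (fun h => h^-1 *: (f (h *: ei + (x + s *: ei) + t *: ej)
                              - f (x + s *: ei + t *: ej))) =
           (fun h => h^-1 *: (f (h *: ei + (x + s *: ei + t *: ej))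
                              - f (x + s *: ei + t *: ej))).
    by apply/funext => h; rewrite !addrA.
  apply: DeriveDef; rewrite /partial /derivable /derive /shift/=.
  - by rewrite E; exact: d1.
  - by rewrite E.
have [|s sle E1] := @line_MVT _ _ F x ei t.
  by move=> s /dF ds; exact: ex_derive.
have [|r rle E2] := @line_MVT _ _ (partial i f) (x + s *: ei) ej t.
  by move=> r rle; have [] := df _ (inB _ _ sle rle).
exists (x + s *: ei + r *: ej); first exact: inB.
rewrite -[LHS]/(F (x + t *: ei) - F x) E1; congr (_ * _).
by have [_ ->] := dF _ sle; rewrite E2.
Qed.

(** Schwarz's theorem: both mixed derivatives, taken at points arbitrarily close
    to [x], equal the same second difference divided by [t ^+ 2]. *)
Lemma partialC f x i j : C2_at f x ->
  partial i (partial j f) x = partial j (partial i f) x.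
Proof.
move=> fC; apply/eqP; rewrite -subr_eq0 -normr_le0.
apply/ler_addgt0Pr => e e0; rewrite add0r.
have [_ _ _ cij] := C2_at_self f x fC i j.
have [_ _ _ cji] := C2_at_self f x fC j i.
have e2 : 0 < e / 2 by rewrite divr_gt0.
have /cvgrPdist_le/(_ _ e2) cij' := cij.
have /cvgrPdist_le/(_ _ e2) cji' := cji.
have /nbhs_ballP[del /= del0 B] : \forall y \near x,
   [/\ derivable f y (delta_mx 0 i) /\ derivable (partial i f) y (delta_mx 0 j),
       derivable f y (delta_mx 0 j) /\ derivable (partial j f) y (delta_mx 0 i),
       `|partial j (partial i f) x - partial j (partial i f) y| <= e / 2 &
       `|partial i (partial j f) x - partial i (partial j f) y| <= e / 2].
  apply: filterS3 fC cij' cji' => y fy Hij Hji.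
  have [fi _ fij _] := fy i j; have [fj _ fji _] := fy j i.
  exact: And4 (conj fi fij) (conj fj fji) Hij Hji.
set K := `|delta_mx 0 i : 'rV[R]_N| + `|delta_mx 0 j : 'rV[R]_N| + 1.
have K0 : 0 < K by rewrite ltr_wpDl// addr_ge0.
set t := del / K.
have t0 : 0 < t by rewrite divr_gt0.
have tdel :
    `|t| * (`|delta_mx 0 i : 'rV[R]_N| + `|delta_mx 0 j : 'rV[R]_N|) < del.
  by rewrite gtr0_norm// /t mulrAC ltr_pdivrMr// ltr_pM2l// /K ltrDl.
have [|//|y By Ey] := @mixed_difference f x i j del t.
  by move=> y /B[].
have [||z Bz Ez] := @mixed_difference f x j i del t.
- by move=> y' /B[].
- by rewrite addrC.
move: B Ey Ez; move: (partial j (partial i f)) => Dij.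
move: (partial i (partial j f)) => Dji B Ey Ez.
have E : Dij y = Dji z.
  apply: (mulfI (lt0r_neq0 t0)); apply: (mulfI (lt0r_neq0 t0)).
  have swap_terms (a b c d : R) : a - b - (c - d) = a - c - (b - d) by ring.
  by rewrite -Ey -Ez [x + t *: delta_mx 0 j + _]addrAC; exact: swap_terms.
have [_ _ H1 _] := B _ By; have [_ _ _ H2] := B _ Bz.
rewrite E in H1; rewrite (splitr e).
by rewrite (le_trans (ler_distD _ _ _) (lerD H2 _))// distrC.
Qed.

Lemma hessian_sym f x : C2_at f x -> (hessian f x)^T = hessian f x.
Proof. by move=> fC; apply/matrixP => i j; rewrite !mxE; exact: partialC. Qed.

End C2.

(** * The Euclidean inner product and symmetric matrices *)

Definition dot {R : realType} {N : nat} (u v : 'rV[R]_N) : R :=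
  \sum_i u 0 i * v 0 i.

Section dot.
Context {R : realType} {N : nat}.
Implicit Types (u v w x y : 'rV[R]_N) (a : R) (H : 'M[R]_N).

Lemma dotC u v : dot u v = dot v u.
Proof. by apply: eq_bigr => i _; rewrite mulrC. Qed.

Lemma dotDl u v w : dot (u + v) w = dot u w + dot v w.
Proof. by rewrite -big_split/=; apply: eq_bigr => i _; rewrite mxE mulrDl. Qed.

Lemma dotZl a u w : dot (a *: u) w = a * dot u w.
Proof. by rewrite mulr_sumr; apply: eq_bigr => i _; rewrite mxE mulrA. Qed.

Lemma dotNl u w : dot (- u) w = - dot u w.
Proof. by rewrite -scaleN1r dotZl mulN1r. Qed.

Lemma dotDr u v w : dot w (u + v) = dot w u + dot w v.
Proof. by rewrite dotC dotDl !(dotC w). Qed.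

Lemma dotZr a u w : dot w (a *: u) = a * dot w u.
Proof. by rewrite dotC dotZl (dotC w). Qed.

Lemma dotNr u w : dot w (- u) = - dot w u.
Proof. by rewrite dotC dotNl (dotC w). Qed.

Lemma dot0l u : dot 0 u = 0. Proof. by rewrite -(scale0r 0) dotZl mul0r. Qed.

Lemma dot0r u : dot u 0 = 0. Proof. by rewrite dotC dot0l. Qed.

Definition dotE := (dotDl, dotDr, dotNl, dotNr, dotZl, dotZr).

Lemma dot_ge0 u : 0 <= dot u u.
Proof. by apply: sumr_ge0 => i _; rewrite -expr2 sqr_ge0. Qed.

Lemma sqr_coord_le_dot u i : u 0 i ^+ 2 <= dot u u.
Proof.
rewrite /dot (bigD1 i)//= -expr2 lerDl.
by apply: sumr_ge0 => j _; rewrite -expr2 sqr_ge0.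
Qed.

Lemma dot_eq0 u : dot u u = 0 -> u = 0.
Proof.
move=> u0; apply/rowP => i; rewrite mxE; apply/eqP.
by rewrite -sqrf_eq0 eq_le sqr_ge0 andbT -u0 sqr_coord_le_dot.
Qed.

Lemma dot_mulmx H u v : dot (u *m H) v = \sum_i u 0 i * \sum_j v 0 j * H i j.
Proof.
rewrite /dot; under eq_bigr do rewrite mxE mulr_suml.
rewrite exchange_big/=; apply: eq_bigr => i _; rewrite mulr_sumr.
by apply: eq_bigr => j _; ring.
Qed.

Lemma dot_mulmx_sym H u v : H^T = H -> dot (u *m H) v = dot (v *m H) u.
Proof.
move=> Hs; rewrite !dot_mulmx; under eq_bigr do rewrite mulr_sumr.
rewrite exchange_big/=; apply: eq_bigr => i _; rewrite mulr_sumr.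
by apply: eq_bigr => j _; rewrite -[in LHS]Hs mxE; ring.
Qed.

Lemma enormE x : enorm x = Num.sqrt (dot x x).
Proof.
by rewrite /enorm; congr Num.sqrt; apply: eq_bigr => i _; rewrite expr2.
Qed.

Lemma enorm_ge0 x : 0 <= enorm x. Proof. exact: sqrtr_ge0. Qed.

Lemma enorm_sqr x : enorm x ^+ 2 = dot x x.
Proof. by rewrite enormE sqr_sqrtr// dot_ge0. Qed.

Lemma enorm_eq0 x : enorm x = 0 -> x = 0.
Proof. by move=> x0; apply: dot_eq0; rewrite -enorm_sqr x0 expr0n. Qed.

Lemma enorm0 : enorm (0 : 'rV[R]_N) = 0.
Proof. by rewrite enormE dot0l sqrtr0. Qed.

Lemma enormN x : enorm (- x) = enorm x.
Proof. by rewrite !enormE !dotE opprK. Qed.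

Lemma enormZ a x : enorm (a *: x) = `|a| * enorm x.
Proof.
by rewrite !enormE !dotE mulrA -expr2 sqrtrM ?sqr_ge0// sqrtr_sqr.
Qed.

Lemma dot_le_enorm x y : dot x y <= enorm x * enorm y.
Proof.
have [x0|xn0] := eqVneq (enorm x) 0.
  by rewrite (enorm_eq0 _ x0) dot0l enorm0 mul0r.
have [y0|yn0] := eqVneq (enorm y) 0.
  by rewrite (enorm_eq0 _ y0) dot0r enorm0 mulr0.
have p0 : 0 < enorm x * enorm y.
  by rewrite mulr_gt0// lt0r ?xn0 ?yn0 enorm_ge0.
have := dot_ge0 (enorm y *: x - enorm x *: y).
rewrite !dotE -!enorm_sqr (dotC y x) -(pmulr_rge0 _ p0) => h.
by rewrite -(ler_pM2l p0); nra.
Qed.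

Lemma enormD x y : enorm (x + y) <= enorm x + enorm y.
Proof.
rewrite -(@ler_pXn2r _ 2)// ?nnegrE ?addr_ge0 ?enorm_ge0//.
rewrite enorm_sqr !dotE sqrrD !enorm_sqr (dotC y x).
by have := dot_le_enorm x y; lra.
Qed.

Lemma coord_le_enorm x i : `|x 0 i| <= enorm x.
Proof. by rewrite enormE -sqrtr_sqr ler_wsqrtr// sqr_coord_le_dot. Qed.

Lemma norm_le_enorm x : `|x| <= enorm x.
Proof.
rewrite /Num.norm/= mx_normrE; apply: bigmax_le; first exact: enorm_ge0.
by move=> [i j] _ /=; rewrite (ord1 i) coord_le_enorm.
Qed.

Lemma continuous_sum (T : topologicalType) (I : Type) (s : seq I)
    (f : I -> T -> R) :
  (forall i, continuous (f i)) -> continuous (fun t => \sum_(i <- s) f i t).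
Proof.
move=> fc; elim: s => [|i s IH].
  have -> : (fun t => \sum_(i <- [::]) f i t) = cst 0.
    by apply/funext => t; rewrite big_nil.
  exact: cst_continuous.
have -> : (fun t => \sum_(j <- i :: s) f j t) =
          (fun t => f i t + \sum_(j <- s) f j t).
  by apply/funext => t; rewrite big_cons.
by move=> t; apply: cvgD; [exact: fc|exact: IH].
Qed.

Lemma continuous_coord i : continuous (fun v : 'rV[R]_N => v 0 i).
Proof. exact: coord_continuous. Qed.

Lemma continuous_dot (T : topologicalType) (f g : T -> 'rV[R]_N) :
  continuous f -> continuous g -> continuous (fun t => dot (f t) (g t)).
Proof.
move=> fc gc; apply: continuous_sum => i t; apply: cvgM.
- apply: (continuous_comp (g := fun v => v 0 i) (fc t)).
  exact: continuous_coord.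
- apply: (continuous_comp (g := fun v => v 0 i) (gc t)).
  exact: continuous_coord.
Qed.

Lemma continuous_enorm : continuous (@enorm R N).
Proof.
have -> : @enorm R N = fun x => Num.sqrt (dot x x).
  by apply/funext => x; exact: enormE.
have dc : continuous (fun x : 'rV[R]_N => dot x x).
  by apply: continuous_dot => y; exact: cvg_id.
by move=> x; apply: continuous_comp; [exact: dc|exact: sqrt_continuous].
Qed.

(** A maximizer [c] of the Rayleigh quotient on the unit sphere exists by
    compactness. The quadratic form [a * dot v v - dot (v *m H) v] is nonnegative
    and vanishes at [c], so its first variation at [c] vanishes in every
    direction, which says that [c] is an eigenvector. *)
Lemma sym_top_eigenvalue H : (0 < N)%N -> H^T = H ->
  exists2 a, eigenvalue H a & forall v, dot (v *m H) v <= a * dot v v.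
Proof.
move=> N0 Hs.
pose S := [set v : 'rV[R]_N | dot v v = 1].
have qc : continuous (fun v : 'rV[R]_N => dot (v *m H) v).
  have -> : (fun v => dot (v *m H) v) =
            (fun v => \sum_i v 0 i * \sum_j v 0 j * H i j).
    by apply/funext => v; exact: dot_mulmx.
  apply: continuous_sum => i x; apply: continuousM.
    exact: continuous_coord.
  apply: continuous_sum => j {}x; apply: continuousM.
    exact: continuous_coord.
  exact: cst_continuous.
have cS : compact S.
  apply: bounded_closed_compact.
  - exists 1; split=> // r r1 v /= v1; rewrite (le_trans (norm_le_enorm v))//.
    by rewrite enormE v1 sqrtr1 ltW.
  - apply: (@closed_comp _ _ (fun v : 'rV[R]_N => dot v v) [set 1]).
      by move=> v _; apply: (continuous_dot _ id id) => y; exact: cvg_id.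
    exact: closed_eq.
have S0 : S !=set0.
  exists (delta_mx 0 (Ordinal N0)).
  rewrite /S/= /dot (bigD1 (Ordinal N0))//= big1 ?addr0.
    by rewrite mxE !eqxx mulr1.
  by move=> i /negPf ni; rewrite mxE ni andbF mul0r.
have [c] := EVT_max_rV S0 cS (continuous_subspaceT qc).
rewrite inE => c1 cmax; set a := dot (c *m H) c.
have amax v : dot (v *m H) v <= a * dot v v.
  have [v0|vn0] := eqVneq (enorm v) 0.
    by rewrite (enorm_eq0 _ v0) !dot0r mulr0.
  have v0 : 0 < enorm v by rewrite lt0r vn0 enorm_ge0.
  have := cmax ((enorm v)^-1 *: v).
  rewrite inE /S/= -scalemxAl !dotE -/a -!enorm_sqr.
  have -> : (enorm v)^-1 * ((enorm v)^-1 * enorm v ^+ 2) = 1 by field.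
  move=> /(_ erefl); rewrite !ler_pdivrMl// => /le_trans; apply.
  by rewrite mulrA mulrC expr2.
exists a => //; apply/eigenvalueP; exists c; last first.
  apply/eqP => c0; move: c1; rewrite /S/= c0 dot0l => /eqP.
  by rewrite eq_sym oner_eq0.
(* The variation in the direction of the defect [u] itself is enough. *)
set u := a *: c - c *m H.
suff /dot_eq0/eqP : dot u u = 0 by rewrite subr_eq0 => /eqP.
have uu : dot u u = a * dot c u - dot (c *m H) u.
  by rewrite -[LHS]/(dot (a *: c - c *m H) u) dotDl dotNl dotZl.
clearbody u.
have pos s : 0 <= 2 * s * dot u u + s ^+ 2 * (a * dot u u - dot (u *m H) u).
  have := amax (c + s *: u).
  rewrite mulmxDl -scalemxAl !dotE uu (dotC u c) (dot_mulmx_sym _ u c Hs).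
  by move: c1; rewrite /S/= => ->; rewrite -/a; lra.
move: (dot u u) (dot_ge0 u) (a * dot u u - _) pos => D D0 K pos.
apply/eqP; rewrite eq_le D0 andbT leNgt; apply/negP => Dp.
have K1 : 0 < `|K| + 1 by rewrite ltr_wpDl.
(* For small negative [s] the linear term of [pos s] dominates. *)
have := pos (- (D / (`|K| + 1))).
set r := D / _; have r0 : 0 < r by rewrite divr_gt0.
have rD : r * (`|K| + 1) = D by rewrite divfK// gt_eqF.
have := ler_norm K => KK; nra.
Qed.

End dot.

(** * Extreme values of the Hessian quadratic form *)

Section hessian.
Context {R : realType} {N : nat}.
Implicit Types (f : 'rV[R]_N -> R) (u v w x y : 'rV[R]_N) (H : 'M[R]_N).

Lemma lambda_max_ge H v : (0 < N)%N -> H^T = H ->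
  dot (v *m H) v <= lambda_max H * dot v v.
Proof.
move=> N0 Hs; have [a aH amax] := sym_top_eigenvalue H N0 Hs.
apply: (le_trans (amax v)); rewrite ler_wpM2r ?dot_ge0//.
apply: ub_le_sup => //; exists a => b /eigenvalueP[w wH w0].
have := amax w; rewrite wH dotZl ler_pM2r// lt0r dot_ge0 andbT.
by apply: contraNneq w0 => /dot_eq0 ->.
Qed.

(** Symmetry matters: without a real eigenvalue the supremum is taken over the
    empty set, where it is [0]. *)
Lemma lambda_max_le H M : (0 < N)%N -> H^T = H ->
  (forall v, dot (v *m H) v <= M * dot v v) -> lambda_max H <= M.
Proof.
move=> N0 Hs HM; have [a aH amax] := sym_top_eigenvalue H N0 Hs.
apply: ge_sup; first by exists a.
move=> b /eigenvalueP[w wH w0].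
have := HM w; rewrite wH dotZl ler_pM2r// lt0r dot_ge0 andbT.
by apply: contraNneq w0 => /dot_eq0 ->.
Qed.

Lemma is_derive_cosZ (k t : R) :
  is_derive t (1 : R) (fun t => cos (k * t)) (- (k * sin (k * t))).
Proof.
have D : is_derive t (1 : R) (fun t => k * t) k.
  rewrite -[X in is_derive _ _ _ X]mulr1; exact: is_deriveZ.
have := @is_derive1_comp _ cos (fun t => k * t) t _ _ (is_derive_cos _) D.
by move=> /is_derive_eq; apply; rewrite mulNr mulrC.
Qed.

Lemma is_derive_sinZ (k t : R) :
  is_derive t (1 : R) (fun t => sin (k * t)) (k * cos (k * t)).
Proof.
have D : is_derive t (1 : R) (fun t => k * t) k.
  rewrite -[X in is_derive _ _ _ X]mulr1; exact: is_deriveZ.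
have := @is_derive1_comp _ sin (fun t => k * t) t _ _ (is_derive_sin _) D.
by move=> /is_derive_eq; apply; rewrite mulrC.
Qed.

Lemma continuous_line x v : continuous (fun t : R => x + t *: v).
Proof.
by move=> t; apply: cvgD; [exact: cvg_cst|exact: scalel_continuous].
Qed.

(** Comparison of [t |-> f (x + t *: v)] with [t |-> f x * cos (k * t)], whose
    second derivative at [0] is [- k ^+ 2 * f x]: the order between the symmetric
    second differences passes to the second derivatives. The sign of [s] selects
    the direction of the comparison. *)
Lemma hessian_cos_test f x v (k s : R) : C2_at f x ->
  (\forall t \near 0,
    0 <= s * (f (x + t *: v) + f (x - t *: v) - 2 * f x * cos (k * t))) ->
  0 <= s * (dot (v *m hessian f x) v + k ^+ 2 * f x).
Proof.
move=> fC fge.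
pose g t := s * (f (x + t *: v) - f x * cos (k * t)).
pose g' t := s * (\sum_i v 0 i * partial i f (x + t *: v)
                   - f x * - (k * sin (k * t))).
pose A := s * (\sum_i v 0 i * \sum_j v 0 j * partial j (partial i f) x
                   - f x * - (k * (k * cos (k * 0)))).
have -> : s * (dot (v *m hessian f x) v + k ^+ 2 * f x) = A.
  rewrite /A mulr0 cos0 dot_mulmx; congr (s * (_ + _)); last by ring.
  by under eq_bigr do under eq_bigr do rewrite mxE.
apply: (@second_difference_test _ g g' A).
- have : \forall t \near 0, C2_at f (x + t *: v).
    have /near_join := fC.
    have : (fun t : R => x + t *: v) @ (0:R) --> x.
      by have := continuous_line x v 0; rewrite /continuous_at scale0r addr0.
    by move=> /[swap] ? /(_ _); apply.
  apply: filterS => t ftC.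
  apply: is_deriveZ; apply: is_deriveB; last first.
    by apply: is_deriveZ; exact: is_derive_cosZ.
  have [d <-] := C2_at_is_derive f _ v ftC.
  exact: is_derive_line.
- apply: is_deriveZ; apply: is_deriveB; last first.
    apply: is_deriveZ; apply: is_deriveN; apply: is_deriveZ.
    exact: is_derive_sinZ.
  rewrite [X in is_derive _ _ X](_ : _ =
    \sum_i (fun t => v 0 i * partial i f (x + t *: v))); last first.
    by apply/funext => t; rewrite fct_sumE.
  apply: is_derive_sum => i; apply: is_deriveZ.
  have [] := C2_at_is_derive_partial f x v i fC.
  have {1 2}-> : x = x + 0 *: v by rewrite scale0r addr0.
  by move=> d <-; exact: is_derive_line.
- apply: filterS fge => t.
  rewrite /g scale0r addr0 mulr0 cos0 scaleNr mulrN cosN; lra.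
Qed.

End hessian.

(** * Euclidean balls *)

Section ball.
Context {R : realType} {N : nat}.
Implicit Types (c x y : 'rV[R]_N) (r : R).

Lemma continuous_dist c : continuous (fun x : 'rV[R]_N => enorm (x - c)).
Proof.
move=> x; apply: (@continuous_comp _ _ _ (fun x => x - c) (@enorm R N)).
  by apply: continuousB; [exact: cvg_id|exact: cst_continuous].
exact: continuous_enorm.
Qed.

Lemma open_eball c r : open (eball c r).
Proof.
apply: (@open_comp _ _ (fun x => enorm (x - c)) [set t | t < r]).
  by move=> x _; exact: continuous_dist.
exact: open_lt.
Qed.

Lemma bounded_eball c r : bounded_set (eball c r).
Proof.
exists (r + enorm c); split; first exact: num_real.
move=> M rM x /= xr; rewrite (le_trans (norm_le_enorm x))//.
have -> : x = (x - c) + c by rewrite subrK.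
by rewrite (le_trans (enormD _ _))// (le_trans _ (ltW rM))// lerD2r ltW.
Qed.

Lemma convex_eball c r : convex_set (eball c r).
Proof.
apply/convex_setW => x y; rewrite !inE => xr yr k k0 k1.
rewrite inE /eball/=.
rewrite -[conv k _ _]/(k%:num *: x + (1 - k%:num) *: y).
have -> : k%:num *: x + (1 - k%:num) *: y - c =
   k%:num *: (x - c) + (1 - k%:num) *: (y - c).
  by apply/rowP => i; rewrite !mxE; ring.
rewrite (le_lt_trans (enormD _ _))// !enormZ !gtr0_norm ?subr_gt0//.
by rewrite /eball/= in xr yr; nra.
Qed.

Lemma diam_eball c r : (0 < N)%N -> 0 < r -> diam (eball c r) = 2 * r.
Proof.
move=> N0 r0.
pose e : 'rV[R]_N := delta_mx 0 (Ordinal N0).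
have e1 : enorm e = 1.
  rewrite enormE /dot (bigD1 (Ordinal N0))//= big1 ?addr0.
    by rewrite mxE !eqxx mulr1 sqrtr1.
  by move=> i /negPf ni; rewrite mxE ni andbF mul0r.
have inb s : `|s| < r -> eball c r (c + s *: e).
  by rewrite /eball/= [c + _]addrC addrK enormZ e1 mulr1.
have ub : ubound [set enorm (p.1 - p.2) | p in eball c r `*` eball c r] (2 * r).
  move=> _ [[x y] /= [xr yr] <-].
  have -> : x - y = (x - c) + - (y - c) by rewrite opprB subrKA.
  rewrite (le_trans (enormD _ _))// enormN.
  by rewrite /eball/= in xr yr; lra.
have mem0 : [set enorm (p.1 - p.2) | p in eball c r `*` eball c r] 0.
  have cr : eball c r c by rewrite /eball/= subrr enorm0.
  by exists (c, c) => //=; rewrite subrr enorm0.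
apply/eqP; rewrite eq_le; apply/andP; split.
  by apply: ge_sup ub; exists 0.
rewrite leNgt; apply/negP => lt.
have d0 : 0 <= diam (eball c r).
  by apply: ub_le_sup mem0; exists (2 * r).
set d := diam _ in lt d0.
(* Halfway between [d / 2] and [r], so that two antipodal points at distance [s]
   from the centre are further apart than [d]. *)
pose s := (d / 2 + r) / 2.
have [s0 sr ds] : [/\ 0 < s, s < r & d < 2 * s] by rewrite /s; split; lra.
suff : 2 * s <= d by lra.
apply: ub_le_sup; first by exists (2 * r).
exists (c + s *: e, c + (- s) *: e) => /=.
  by split; apply: inb; rewrite ?normrN gtr0_norm.
rewrite opprD addrACA subrr add0r -scalerBl opprK enormZ e1 mulr1.
by rewrite gtr0_norm; lra.
Qed.

End ball.

(** * Smooth test functions and contact points *)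

Section smooth.
Context {R : realType} {N : nat}.
Implicit Types (f g : 'rV[R]_N -> R) (x v : 'rV[R]_N).

(** A class of functions closed under partial derivatives and made of continuous
    functions, so that membership alone implies smoothness. It contains the test
    function of the upper bound. *)
Inductive elementary : ('rV[R]_N -> R) -> Prop :=
| elementary_cst (a : R) : elementary (fun=> a)
| elementary_coord i : elementary (fun x => x 0 i)
| elementaryD f g : elementary f -> elementary g ->
    elementary (fun x => f x + g x)
| elementaryM f g : elementary f -> elementary g ->
    elementary (fun x => f x * g x)
| elementary_sin f : elementary f -> elementary (fun x => sin (f x))
| elementary_cos f : elementary f -> elementary (fun x => cos (f x)).

Lemma elementary_sum (I : Type) (s : seq I) (F : I -> 'rV[R]_N -> R) :
  (forall i, elementary (F i)) -> elementary (fun x => \sum_(i <- s) F i x).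
Proof.
move=> eF; elim: s => [|i s IH].
  rewrite (_ : (fun _ => _) = fun=> 0); first exact: elementary_cst.
  by apply/funext => x; rewrite big_nil.
rewrite (_ : (fun _ => _) = fun x => F i x + \sum_(j <- s) F j x).
  exact: elementaryD.
by apply/funext => x; rewrite big_cons.
Qed.

Lemma elementary_continuous f : elementary f -> continuous f.
Proof.
elim=> [a|i|{}f g _ fc _ gc|{}f g _ fc _ gc|{}f _ fc|{}f _ fc].
- exact: cst_continuous.
- exact: continuous_coord.
- by move=> x; apply: continuousD; [exact: fc|exact: gc].
- by move=> x; apply: continuousM; [exact: fc|exact: gc].
- by move=> x; apply: (continuous_comp (fc x)); exact: continuous_sin.
- by move=> x; apply: (continuous_comp (fc x)); exact: continuous_cos.
Qed.

Lemma elementary_derive f v : elementary f ->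
  exists2 df, elementary df & forall x, is_derive x v f (df x).
Proof.
elim=> [a|i|{}f g _ [df edf Df] _ [dg edg Dg]
  |{}f g ef [df edf Df] eg [dg edg Dg]|{}f ef [df edf Df]|{}f ef [df edf Df]].
- by exists (fun=> 0) => [|x]; [exact: elementary_cst|exact: is_derive_cst].
- exists (fun=> v 0 i) => [|x]; first exact: elementary_cst.
  have {1}-> : x = x + 0 *: v by rewrite scale0r addr0.
  apply/is_derive_lineP.
  have -> : (fun h : R => (x + h *: v) 0 i) = (fun h => x 0 i + v 0 i * h).
    by apply/funext => h; rewrite !mxE mulrC.
  rewrite -[X in is_derive _ _ _ X]add0r -[v 0 i in X in is_derive _ _ _ X]mulr1.
  by apply: is_deriveD.
- exists (fun x => df x + dg x) => [|x]; first exact: elementaryD.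
  by have := Df x; have := Dg x => ? ?; exact: is_deriveD.
- exists (fun x => f x * dg x + g x * df x) => [|x].
    by apply: elementaryD; exact: elementaryM.
  by have := Df x; have := Dg x => ? ?; exact: is_deriveM.
- exists (fun x => cos (f x) * df x) => [|x].
    by apply: elementaryM => //; exact: elementary_cos.
  exact: is_derive_comp_real (Df x) (is_derive_sin _).
- exists (fun x => (-1 * sin (f x)) * df x) => [|x].
    apply: elementaryM => //; apply: elementaryM; first exact: elementary_cst.
    exact: elementary_sin.
  by rewrite mulN1r; exact: is_derive_comp_real (Df x) (is_derive_cos _).
Qed.

Lemma elementary_derivable f x v : elementary f -> derivable f x v.
Proof. by move=> /(elementary_derive _ v)[df _ D]; have [] := D x. Qed.

Lemma elementary_partial f i : elementary f -> elementary (partial i f).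
Proof.
move=> /(elementary_derive _ (delta_mx 0 i))[df edf D].
suff -> : partial i f = df by [].
by apply/funext => x; have [_] := D x.
Qed.

Lemma elementary_C2 f x : elementary f -> C2_at f x.
Proof.
move=> ef; apply: filterE => y i j.
have ei := elementary_partial f i ef.
have eij := elementary_partial (partial i f) j ei.
apply: And4.
- exact: elementary_derivable ef.
- exact: (elementary_continuous _ ei y).
- exact: elementary_derivable ei.
- exact: (elementary_continuous _ eij y).
Qed.

End smooth.

Section touching.
Context {R : realType} {N : nat}.

(** The contact constant [tau] is the smallest [t] for which [phi <= t * w]
    somewhere on [K]. If [tau * w < phi] held on all of [K], then lower
    semicontinuity would propagate it to [t * w < phi] locally in both the point
    and [t], and by compactness to all of [K] for all [t] near [tau],
    contradicting the choice of [tau]. *)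
Lemma touch_from_below (Omega K : set 'rV[R]_N) (phi w : 'rV[R]_N -> R) :
  open Omega -> K `<=` Omega -> compact K -> lsc_on Omega phi ->
  (forall x, Omega x -> 0 < phi x) -> continuous w ->
  (forall x, K x -> 0 <= w x) -> (exists2 x, K x & 0 < w x) ->
  exists tau x0, [/\ 0 < tau, K x0, phi x0 = tau * w x0 &
    forall x, K x -> tau * w x <= phi x].
Proof.
move=> oO KO cK lphi phi0 cw w0 [x1 Kx1 w1].
pose T := [set t | exists2 x, K x & phi x <= t * w x].
have T0 : lbound T 0.
  move=> t [x Kx phixt]; rewrite leNgt; apply/negP => t0.
  have := phi0 _ (KO _ Kx); rewrite ltNge => /negP; apply.
  by rewrite (le_trans phixt)// mulr_le0_ge0 ?w0// ltW.
have T1 : T (phi x1 / w x1) by exists x1; rewrite ?divfK ?gt_eqF.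
have hT : has_inf T by split; [exists (phi x1 / w x1)|exists 0].
set tau := inf T.
have tauw x : K x -> tau * w x <= phi x.
  move=> Kx; have := w0 _ Kx; rewrite le_eqVlt => /orP[/eqP<-|wx].
    by rewrite mulr0 ltW//; exact/phi0/KO.
  rewrite -ler_pdivlMr//; apply: ge_inf; first by exists 0.
  by exists x; rewrite ?divfK ?gt_eqF.
suff [x0 Kx0 le0] : exists2 x, K x & phi x <= tau * w x.
  have E : phi x0 = tau * w x0 by apply/eqP; rewrite eq_le le0 tauw.
  exists tau, x0; split => //.
  have := phi0 _ (KO _ Kx0); rewrite E => p0.
  have := w0 _ Kx0; rewrite le_eqVlt => /orP[/eqP wx|wx].
    by move: p0; rewrite -wx mulr0 ltxx.
  by move: p0; rewrite pmulr_lgt0.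
apply: contrapT => nex.
have lt x : K x -> tau * w x < phi x.
  by move=> Kx; rewrite ltNge; apply/negP => ?; apply: nex; exists x.
have : \forall t \near tau, K `<=` [set x | t * w x < phi x].
  apply: ((compact_near_coveringP K).1 cK _ (nbhs tau)
    (fun t x => t * w x < phi x)) => x Kx /=.
  pose a := (tau * w x + phi x) / 2.
  have [a1 a2] : tau * w x < a /\ a < phi x by have := lt _ Kx; rewrite /a; lra.
  have [V xV aV] : exists2 V, nbhs x V & forall y, V y -> a < phi y.
    have [|V xV aV] := lphi x a; first by rewrite lte_fin.
    exists V; last by move=> y /aV; rewrite lte_fin.
    rewrite (@nbhs_subspace_interior _ Omega)//.
    by apply: open_nbhs_nbhs; split=> //; exact: KO.
  have : \forall y \near (x, tau), y.2 * w y.1 < a.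
    have lim : y.2 * w y.1 @[y --> (x, tau)] --> tau * w x.
      apply: cvgM; first exact: cvg_snd.
      by apply: (cvg_comp fst w); [exact: cvg_fst|exact: cw].
    exact: (cvgr_lt _ lim).
  have : \forall y \near (x, tau), V y.1 by apply: (cvg_fst (F := nbhs x)).
  by apply: filterS2 => -[y t] /= /aV ay ta; exact: lt_trans ay.
move=> /nbhs_ballP[e /= e0 B].
have [t [x Kx phix] te] := inf_adherent e0 hT.
have tt : tau <= t by apply: ge_inf; [exists 0|exists x].
have : t * w x < phi x.
  apply: B => //; rewrite -ball_normE/= distrC ger0_norm ?subr_ge0//.
  by rewrite ltrBlDl.
by rewrite ltNge phix.
Qed.

End touching.

(** * The upper bound on convex sets of given diameter *)

Section upper_bound.
Context {R : realType} {N : nat}.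
Implicit Types (Omega : set 'rV[R]_N) (p q x e : 'rV[R]_N).

Lemma open_enorm_nbhs Omega p : open Omega -> Omega p ->
  exists2 r : R, 0 < r & forall z, enorm z <= r -> Omega (p + z).
Proof.
move=> oO Op; have : nbhs p Omega by apply: open_nbhs_nbhs.
move=> /nbhs_ballP[r /= r0 B]; exists (r / 2); first by rewrite divr_gt0.
move=> z zr; apply: B; rewrite -ball_normE/= opprD addNKr normrN.
by rewrite (le_lt_trans (norm_le_enorm z))// (le_lt_trans zr)//; lra.
Qed.

Lemma convex_setE Omega p q (t : R) : convex_set Omega -> Omega p -> Omega q ->
  0 <= t <= 1 -> Omega ((1 - t) *: p + t *: q).
Proof.
move=> cO Op Oq /andP[t0 t1].
have := cO q p (Itv01 t0 t1); rewrite !inE => /(_ Oq Op).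
by rewrite addrC.
Qed.

(** The component of [x - p] orthogonal to [e], for a unit vector [e]. *)
Definition transversal p e x : 'rV[R]_N := x - p - dot e (x - p) *: e.

Lemma dot_transversal p e x :
  dot (transversal p e x) (transversal p e x) =
  \sum_i ((x 0 i + - p 0 i) + - (\sum_j e 0 j * (x 0 j + - p 0 j)) * e 0 i) ^+ 2.
Proof.
apply: eq_bigr => i _; rewrite !mxE -expr2 mulNr; congr ((_ - _ * _) ^+ 2).
by apply: eq_bigr => j _; rewrite !mxE.
Qed.

(** The function is rewritten as an explicit expression in the coordinates. *)
Lemma elementary_cylinder_bump p e (k r : R) :
  elementary (fun x => sin (k * dot e (x - p)) *
    (r ^+ 2 - dot (transversal p e x) (transversal p e x))).
Proof.
have eB i : elementary (fun x : 'rV[R]_N => x 0 i + - p 0 i).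
  by apply: elementaryD; [exact: elementary_coord|exact: elementary_cst].
have eS : elementary (fun x : 'rV[R]_N => \sum_j e 0 j * (x 0 j + - p 0 j)).
  by apply: elementary_sum => j; apply: elementaryM => //; exact: elementary_cst.
have ey i : elementary (fun x : 'rV[R]_N => (x 0 i + - p 0 i) +
    -1 * (\sum_j e 0 j * (x 0 j + - p 0 j)) * e 0 i).
  apply: elementaryD => //; apply: elementaryM; last exact: elementary_cst.
  by apply: elementaryM => //; exact: elementary_cst.
have -> : (fun x => sin (k * dot e (x - p)) *
    (r ^+ 2 - dot (transversal p e x) (transversal p e x))) =
  (fun x : 'rV[R]_N => sin (k * \sum_j e 0 j * (x 0 j + - p 0 j)) *
    (r ^+ 2 + -1 * \sum_i (((x 0 i + - p 0 i) +
       -1 * (\sum_j e 0 j * (x 0 j + - p 0 j)) * e 0 i) *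
       ((x 0 i + - p 0 i) +
       -1 * (\sum_j e 0 j * (x 0 j + - p 0 j)) * e 0 i)))).
  apply/funext => x; rewrite dot_transversal mulN1r.
  congr (sin (k * _) * (_ - _)).
    by apply: eq_bigr => j _; rewrite !mxE.
  by apply: eq_bigr => i _; rewrite mulN1r expr2.
apply: elementaryM.
  by apply: elementary_sin; apply: elementaryM => //; exact: elementary_cst.
apply: elementaryD; first exact: elementary_cst.
apply: elementaryM; first exact: elementary_cst.
by apply: elementary_sum => i; apply: elementaryM.
Qed.

(** Let [e] be the unit vector from [p] to [q], [S] the coordinate along [e] and
    [y] the transversal displacement. The function
    [w = sin (k * S) * (r ^+ 2 - |y| ^+ 2)] is positive inside the cylinder [D]
    around the segment and vanishes on its boundary, so a multiple of it touches
    [phi] at an interior point. Since [y] does not change along [e], the second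
    derivative of [w] along [e] is exactly [- k ^+ 2 * w]; a test function such
    as [sin (k * S) - C * |y| ^+ 2] would lose this identity off the axis. *)
Lemma supersolution_le_segment Omega (mu : R) phi p q :
  (0 < N)%N -> open_bounded_convex Omega -> lsc_on Omega phi ->
  (forall x, Omega x -> 0 < phi x) ->
  viscosity_supersolution Omega mu phi ->
  Omega p -> Omega q -> 0 < enorm (q - p) -> mu <= (pi / enorm (q - p)) ^+ 2.
Proof.
move=> N0 [oO bO cO] lphi phi0 visc Op Oq L0.
set L := enorm (q - p) in L0 *; set k := pi / L.
have k0 : 0 < k by rewrite divr_gt0// pi_gt0.
have kL : k * L = pi by rewrite divfK// gt_eqF.
pose e := L^-1 *: (q - p).
have ee : dot e e = 1.
  by rewrite /e dotZl dotZr -enorm_sqr -/L; field; rewrite gt_eqF.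
have qE : q = p + L *: e.
  by rewrite /e scalerA divff ?gt_eqF// scale1r addrC subrK.
have [r1 r10 B1] := open_enorm_nbhs Omega p oO Op.
have [r2 r20 B2] := open_enorm_nbhs Omega q oO Oq.
pose r := Num.min r1 r2.
have r0 : 0 < r by rewrite lt_min r10.
pose S x := dot e (x - p); pose y := transversal p e.
pose D := [set x | [/\ 0 <= S x, S x <= L & dot (y x) (y x) <= r ^+ 2]].
have xE x : x = p + S x *: e + y x.
  by rewrite /y /transversal -/(S x) [in RHS]addrAC -addrA subrK addrC subrK.
(* Every point of [D] lies on the segment [p, q] translated by [y x]. *)
have DO : D `<=` Omega.
  move=> x [S0 SL yr].
  have yr' : enorm (y x) <= r.
    by rewrite -(@ler_pXn2r _ 2)// ?nnegrE ?enorm_ge0 ?(ltW r0)// enorm_sqr.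
  have -> : x = (1 - S x / L) *: (p + y x) + (S x / L) *: (q + y x).
    rewrite [LHS]xE qE; move: (y x) (S x) (e) => z s e'.
    by apply/rowP => i; rewrite !mxE; field; rewrite gt_eqF.
  apply: convex_setE => //.
  - by apply: B1; rewrite (le_trans yr')// ge_min lexx.
  - by apply: B2; rewrite (le_trans yr')// ge_min lexx orbT.
  - by rewrite divr_ge0 ?(ltW L0)//= ler_pdivrMr// mul1r.
have cxp : continuous (fun x : 'rV[R]_N => x - p).
  by move=> x; apply: continuousB; [exact: cvg_id|exact: cst_continuous].
have cS : continuous S.
  apply: (@continuous_dot _ _ _ (fun=> e) (fun x => x - p)).
    exact: cst_continuous.
  exact: cxp.
have cy : continuous (fun x => dot (y x) (y x)).
  suff cyx : continuous y by exact: (@continuous_dot _ _ _ y y).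
  move=> x; apply: (@continuousB _ _ _ (fun x => x - p) (fun x => S x *: e)).
    exact: cxp.
  apply: (@continuous_comp _ _ _ S (fun s => s *: e)); first exact: cS.
  exact: scalel_continuous.
have clD : closed D.
  have -> : D = [set x | S x \in `[0, L]] `&` [set x | dot (y x) (y x) <= r ^+ 2].
    apply/seteqP; split=> x /=; rewrite in_itv/=.
      by move=> [s0 sL yr]; split=> //; apply/andP.
    by move=> [/andP[s0 sL] yr].
  apply: closedI.
    apply: (@closed_comp _ _ S [set` `[0, L]]); first by move=> x _; exact: cS.
    exact: itv_closed.
  apply: (@closed_comp _ _ (fun x => dot (y x) (y x)) [set t | t <= r ^+ 2]).
    by move=> x _; exact: cy.
  exact: closed_le.
have cD : compact D.
  apply: bounded_closed_compact clD; have [M [rM BM]] := bO.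
  by exists M; split=> // t Mt x Dx; exact: (BM t Mt x (DO x Dx)).
pose w x := sin (k * S x) * (r ^+ 2 - dot (y x) (y x)).
have ew : elementary w := elementary_cylinder_bump p e k r.
have kS x : 0 <= S x -> S x <= L -> 0 <= k * S x <= pi.
  by move=> s0 sL; rewrite mulr_ge0 ?(ltW k0)//= -kL ler_pM2l.
have w0 x : D x -> 0 <= w x.
  move=> [s0 sL yr]; rewrite mulr_ge0 ?subr_ge0//.
  by apply: sin_ge0_pi; exact: kS.
have Sline x t : S (x + t *: e) = S x + t.
  by rewrite /S addrAC (dotDr (x - p)) dotZr ee mulr1.
have yline x t : y (x + t *: e) = y x.
  rewrite /y /transversal -!/(S _) Sline; apply/rowP => i; rewrite !mxE; ring.
have Sp : S p = 0 by rewrite /S subrr dot0r.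
have yp : y p = 0 by rewrite /y /transversal -/(S p) Sp scale0r subrr subr0.
have wpos : exists2 x, D x & 0 < w x.
  have S2 : S (p + (L / 2) *: e) = L / 2 by rewrite Sline Sp add0r.
  have y2 : dot (y (p + (L / 2) *: e)) (y (p + (L / 2) *: e)) = 0.
    by rewrite yline yp dot0l.
  exists (p + (L / 2) *: e).
    by rewrite /D/= S2 y2 sqr_ge0; split=> //; lra.
  rewrite /w S2 y2 subr0 mulr_gt0 ?exprn_gt0//.
  have pi0 := pi_gt0 R.
  by apply: sin_gt0_pi; rewrite mulrA kL; lra.
have [tau [x0 [tau0 Dx0 phix0 tauw]]] :=
  touch_from_below Omega D phi w oO DO cD lphi phi0 (elementary_continuous w ew)
    w0 wpos.
have wx0 : 0 < w x0.
  by have := phi0 _ (DO _ Dx0); rewrite phix0 pmulr_rgt0.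
(* [w] vanishes on the boundary of [D] but not at [x0]. *)
have nD : \forall x \near x0, D x.
  have [s0 sL yr] := Dx0.
  have yltr : dot (y x0) (y x0) < r ^+ 2.
    rewrite lt_neqAle yr andbT; apply: contraTneq wx0 => E.
    by rewrite /w E subrr mulr0 ltxx.
  have sl : 0 < S x0.
    rewrite lt_neqAle s0 andbT eq_sym; apply: contraTneq wx0 => E.
    by rewrite /w E mulr0 sin0 mul0r ltxx.
  have sr : S x0 < L.
    rewrite lt_neqAle sL andbT; apply: contraTneq wx0 => E.
    by rewrite /w E kL sinpi mul0r ltxx.
  have n1 := cvgr_gt _ (cS x0) _ sl.
  have n2 := cvgr_lt _ (cS x0) _ sr.
  have n3 := cvgr_lt _ (cy x0) _ yltr.
  near=> x; split; apply: ltW; near: x; [exact: n1|exact: n2|exact: n3].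
pose psi x := tau * w x.
have epsi : elementary psi.
  by apply: elementaryM => //; exact: elementary_cst.
have psiC := elementary_C2 psi x0 epsi.
have Ox0 := DO _ Dx0.
have : mu * phi x0 <= - lambda_max (hessian psi x0).
  apply: visc => //.
  apply: filterS nD => x Dx _.
  by rewrite phix0 subrr subr_ge0; exact: tauw.
have Hs := hessian_sym psi x0 psiC.
have := lambda_max_ge (hessian psi x0) e N0 Hs.
have := @hessian_cos_test _ _ psi x0 e k 1 psiC.
rewrite ee mulr1 !mul1r => Hcos le1 le2.
have : 0 <= dot (e *m hessian psi x0) e + k ^+ 2 * psi x0.
  apply: Hcos; apply: filterE => t.
  rewrite -scaleNr /psi /w !Sline !yline.
  have -> : k * (S x0 + - t) = k * S x0 + - (k * t) by ring.
  rewrite (mulrDr k) !sinD cosN sinN mul1r.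
  set A := sin _; set B := cos _; set C := cos _; set E := sin _.
  set F := r ^+ 2 - _; rewrite le_eqVlt; apply/orP; left; apply/eqP; ring.
rewrite -[psi x0]/(tau * w x0) -phix0 => le3.
rewrite -(ler_pM2r (phi0 _ Ox0)); move: le1 le2 le3.
lra.
Unshelve. all: by end_near. Qed.

(** If [mu] exceeded [(pi / d) ^+ 2], a segment longer than [pi / Num.sqrt mu]
    would fit in [Omega] and contradict [supersolution_le_segment]. *)
Lemma supersolution_le_diam Omega (mu d : R) phi :
  (0 < N)%N -> 0 < d -> open_bounded_convex Omega -> diam Omega = d ->
  lsc_on Omega phi -> (forall x, Omega x -> 0 < phi x) ->
  viscosity_supersolution Omega mu phi -> mu <= (pi / d) ^+ 2.
Proof.
move=> N0 d0 oO dO lphi phi0 visc; rewrite leNgt; apply/negP => mud.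
have pi0 := pi_gt0 R.
have mu0 : 0 < mu by rewrite (le_lt_trans _ mud)// sqr_ge0.
have sm0 : 0 < Num.sqrt mu by rewrite sqrtr_gt0.
have pd0 : 0 < pi / d by rewrite divr_gt0.
have pid : pi / d < Num.sqrt mu.
  by rewrite -(@ltr_pXn2r _ 2)// ?nnegrE ?(ltW pd0) ?(ltW sm0)// sqr_sqrtr// ltW.
set S := [set enorm (p.1 - p.2) | p in Omega `*` Omega].
have S0 : S !=set0.
  apply/set0P/eqP => S0; move: dO; rewrite /diam -/S S0 sup0 => E.
  by move: d0; rewrite -E ltxx.
have [|_ [[q p] /= [Oq Op] <-] Lgt] := @sup_gt _ S (pi / Num.sqrt mu) S0.
  by rewrite -/(diam Omega) dO ltr_pdivrMr// -ltr_pdivrMl// mulrC.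
have L0 : 0 < enorm (q - p) by rewrite (lt_trans _ Lgt)// divr_gt0.
have := supersolution_le_segment Omega mu phi p q N0 oO lphi phi0 visc Op Oq L0.
apply/negP; rewrite -ltNge -[ltRHS](sqr_sqrtr (ltW mu0)).
rewrite ltr_pXn2r// ?nnegrE ?(ltW sm0) ?divr_ge0 ?ltW//.
by rewrite ltr_pdivrMr// -ltr_pdivrMl// mulrC.
Qed.

End upper_bound.

(** * The supersolution on the ball *)

Section lower_bound.
Context {R : realType}.

Lemma cos_nonincreasing (a b : R) :
  0 <= a -> a <= b -> b <= pi -> cos b <= cos a.
Proof.
move=> a0; rewrite le_eqVlt => /orP[/eqP->//|ab] bpi.
have b0 := le_trans a0 (ltW ab); have api := le_trans (ltW ab) bpi.
by rewrite ltW// ltr_cos ?in_itv/= ?a0 ?bpi ?b0 ?api.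
Qed.

(** Concavity of [sin] on [[0, pi]]: its slope from [a] to [b] is at most
    [cos a], which is at most its slope from [0] to [a]. *)
Lemma sinc_nonincreasing (a b : R) : 0 < a -> a <= b -> b <= pi ->
  sin b / b <= sin a / a.
Proof.
move=> a0 ab bpi; have b0 := lt_le_trans a0 ab.
rewrite ler_pdivrMr// mulrAC ler_pdivlMr//.
have D (x y : R) : x <= y ->
    exists2 c, c \in `[x, y] & sin y - sin x = cos c * (y - x).
  move=> xy; apply: (@MVT_segment _ sin cos x y xy).
  by apply: continuous_subspaceT; exact: continuous_sin.
have [z zI Ez] := D _ _ (ltW a0).
have /andP[z0 za] : 0 <= z <= a by rewrite in_itv/= in zI.
have [x xI Ex] := D _ _ ab.
have /andP[ax xb] : a <= x <= b by rewrite in_itv/= in xI.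
rewrite sin0 !subr0 in Ez.
have cz := cos_nonincreasing z a z0 za (le_trans ab bpi).
have cx := cos_nonincreasing a x (ltW a0) ax (le_trans xb bpi).
have sa : a * cos a <= sin a by rewrite Ez mulrC ler_wpM2r// ltW.
have sb : sin b - sin a <= cos a * (b - a) by rewrite Ex ler_wpM2r// subr_ge0.
nra.
Qed.

Lemma is_derive_cos_sqrt (t : R) : 0 < t ->
  is_derive t (1 : R) (fun t => cos (Num.sqrt t))
    (- (sin (Num.sqrt t) / Num.sqrt t) / 2).
Proof.
move=> t0.
have := @is_derive1_comp _ cos Num.sqrt t _ _ (is_derive_cos _)
  (is_derive1_sqrt t0).
by move=> /is_derive_eq; apply; rewrite invfM; ring.
Qed.

(** Convexity of [t |-> cos (Num.sqrt t)] on [[0, pi ^+ 2]]: its derivative is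
    [- sin s / (2 * s)] at [t = s ^+ 2]. The bound [0 < C] keeps away from the
    origin, where [Num.sqrt] is not differentiable. *)
Lemma cos_sqrt_spread (A B C D : R) : 0 < C -> C <= A -> C <= B ->
  A + B = C + D -> D <= pi ^+ 2 ->
  cos (Num.sqrt A) + cos (Num.sqrt B) <= cos (Num.sqrt C) + cos (Num.sqrt D).
Proof.
move=> C0 CA CB ABCD Dpi.
wlog AB : A B CA CB ABCD / A <= B.
  move=> W; have [AB|/ltW BA] := leP A B; first exact: W.
  by rewrite addrC; apply: W => //; rewrite addrC.
have BD : B <= D by lra.
have mvt (x y : R) : 0 < x -> x <= y -> exists2 z, z \in `[x, y] &
    cos (Num.sqrt y) - cos (Num.sqrt x) =
    - (sin (Num.sqrt z) / Num.sqrt z) / 2 * (y - x).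
  move=> x0 xy.
  have dcs z : z \in `[x, y] -> is_derive z (1 : R) (fun t => cos (Num.sqrt t))
      (- (sin (Num.sqrt z) / Num.sqrt z) / 2).
    rewrite in_itv/= => /andP[xz _]; apply: is_derive_cos_sqrt.
    exact: lt_le_trans xz.
  have ccs : {within `[x, y], continuous (fun t : R => cos (Num.sqrt t))}.
    by apply: derivable_within_continuous => z /dcs dz; exact: ex_derive.
  have [z zI E] := MVT_segment xy (fun z zI => dcs z (subset_itv_oo_cc zI)) ccs.
  by exists z.
have [z1 z1I E1] := mvt C A C0 CA.
have /andP[Cz1 z1A] : C <= z1 <= A by rewrite in_itv/= in z1I.
have [z2 z2I E2] := mvt B D (lt_le_trans C0 CB) BD.
have /andP[Bz2 z2D] : B <= z2 <= D by rewrite in_itv/= in z2I.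
have DB : D - B = A - C by lra.
have z10 : 0 < Num.sqrt z1 by rewrite sqrtr_gt0 (lt_le_trans C0).
have z12 : Num.sqrt z1 <= Num.sqrt z2.
  by rewrite ler_wsqrtr// (le_trans z1A)// (le_trans AB).
have z2pi : Num.sqrt z2 <= pi.
  rewrite -[leRHS]ger0_norm ?pi_ge0// -sqrtr_sqr ler_wsqrtr//.
  exact: le_trans Dpi.
have := sinc_nonincreasing _ _ z10 z12 z2pi.
rewrite DB in E2.
move: (sin (Num.sqrt z1) / _) (sin (Num.sqrt z2) / _) E1 E2 => s1 s2 E1 E2 s12.
have AC : 0 <= A - C by rewrite subr_ge0.
have := ler_wpM2r AC s12; lra.
Qed.

Context {N : nat}.
Implicit Types (x c v X H : 'rV[R]_N).

(** By the parallelogram identity [|X + H| ^+ 2] and [|X - H| ^+ 2] have the same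
    sum as [(|X| + |H|) ^+ 2] and [(|X| - |H|) ^+ 2], and by Cauchy-Schwarz they
    lie between them. So [cos_sqrt_spread] bounds the left-hand side by its value
    for collinear vectors, where the addition formula gives the right-hand
    side. *)
Lemma cos_enorm_midpoint X H : X = 0 \/ enorm H < enorm X ->
  enorm X + enorm H <= pi ->
  cos (enorm (X + H)) + cos (enorm (X - H)) <= 2 * cos (enorm X) * cos (enorm H).
Proof.
have [->|Xn0] := eqVneq X 0.
  move=> _ _; rewrite add0r sub0r enormN enorm0 cos0; lra.
move=> [/eqP|HX XHpi]; first by rewrite (negbTE Xn0).
have H0 := enorm_ge0 H; have X0 := enorm_ge0 X.
have -> : 2 * cos (enorm X) * cos (enorm H) =
    cos (Num.sqrt ((enorm X - enorm H) ^+ 2)) +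
    cos (Num.sqrt ((enorm X + enorm H) ^+ 2)).
  rewrite !sqrtr_sqr !cos_norm cosB cosD; ring.
have h1 := dot_le_enorm X H; have h2 := dot_le_enorm X (- H).
rewrite dotNr enormN in h2.
have EA : dot (X + H) (X + H) = enorm X ^+ 2 + 2 * dot X H + enorm H ^+ 2.
  by rewrite !enorm_sqr !dotE (dotC H X); ring.
have EB : dot (X - H) (X - H) = enorm X ^+ 2 - 2 * dot X H + enorm H ^+ 2.
  by rewrite !enorm_sqr !dotE (dotC H X); ring.
rewrite !(@enormE _ _ (_ + _)) EA EB; apply: cos_sqrt_spread.
- by rewrite exprn_gt0// subr_gt0.
- lra.
- lra.
- ring.
- by rewrite ler_pXn2r// ?nnegrE ?pi_ge0 ?addr_ge0.
Qed.

Lemma near_cos_midpoint x v (k : R) : 0 < k -> k * enorm x < pi / 2 ->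
  \forall t \near 0,
  cos (k * enorm (x + t *: v)) + cos (k * enorm (x - t *: v)) <=
  2 * cos (k * enorm x) * cos (k * enorm v * t).
Proof.
move=> k0 kx; have pi0 := pi_gt0 R.
have kE y : k * enorm y = enorm (k *: y) by rewrite enormZ gtr0_norm.
have HE t : cos (k * enorm v * t) = cos (enorm (k *: (t *: v))).
  rewrite -kE enormZ -cos_norm normrM ger0_norm ?mulr_ge0 ?(ltW k0) ?enorm_ge0//.
  by congr cos; ring.
have small e : 0 < e -> \forall t \near (0:R), k * enorm (t *: v) < e.
  move=> e0; have K0 : 0 < k * enorm v + 1.
    by rewrite ltr_wpDl// mulr_ge0 ?enorm_ge0 ?ltW.
  apply/nbhs_ballP; exists (e / (k * enorm v + 1)); first exact: divr_gt0.
  move=> t; rewrite -ball_normE/= sub0r normrN ltr_pdivlMr// => te.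
  rewrite enormZ; apply: le_lt_trans te.
  by rewrite mulrCA ler_wpM2l// lerDl.
have [x0|xn0] := eqVneq x 0.
  apply: filterS (small _ pi0) => t tpi.
  rewrite HE !kE scalerDr scalerBr; apply: cos_enorm_midpoint.
    by left; rewrite x0 scaler0.
  by rewrite -!kE x0 enorm0 mulr0 add0r ltW.
have kx0 : 0 < k * enorm x.
  rewrite mulr_gt0// lt0r enorm_ge0 andbT.
  by apply: contraNneq xn0 => /enorm_eq0 ->.
apply: filterS (small _ kx0) => t tx.
rewrite HE !kE scalerDr scalerBr; apply: cos_enorm_midpoint.
  by right; rewrite -!kE.
by rewrite -!kE; lra.
Qed.

(** A test function touching [phi] from below inherits its upper bound on
    symmetric second differences from [near_cos_midpoint]. *)
Lemma ball_supersolution c (d : R) : (0 < N)%N -> 0 < d ->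
  let phi x := cos (pi / d * enorm (x - c)) in
  [/\ lsc_on (eball c (d / 2)) phi,
      (forall x, eball c (d / 2) x -> 0 < phi x) &
      viscosity_supersolution (eball c (d / 2)) ((pi / d) ^+ 2) phi].
Proof.
move=> N0 d0 phi; have pi0 := pi_gt0 R.
set k := pi / d; have k0 : 0 < k by rewrite divr_gt0.
have kd : k * d = pi by rewrite divfK// gt_eqF.
have kball x : eball c (d / 2) x -> k * enorm (x - c) < pi / 2.
  by rewrite /eball/= => xd; rewrite -kd -mulrA ltr_pM2l.
split.
- move=> x a ax; exists [set y | a < phi y]; last by move=> y; rewrite lte_fin.
  rewrite lte_fin in ax.
  have cd : continuous (fun y : 'rV[R]_N => k * enorm (y - c)).
    move=> y; apply: (continuous_comp (continuous_dist c y)).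
    exact: mulrl_continuous.
  have cphi : continuous phi.
    by move=> y; apply: (continuous_comp (cd y)); exact: continuous_cos.
  have : {within eball c (d / 2), continuous phi} by exact: continuous_subspaceT.
  by move=> /(_ x) /cvgr_gt /(_ _ ax).
- move=> x /kball kx; apply: cos_gt0_pihalf; rewrite kx andbT.
  rewrite (@lt_le_trans _ _ 0)// ?oppr_lt0 ?divr_gt0//.
  by rewrite mulr_ge0 ?(ltW k0) ?enorm_ge0.
move=> x0 psi Ox0 psiC touch phipsi.
have Hs := hessian_sym psi x0 psiC.
rewrite lerNr; apply: lambda_max_le => // v.
have below : \forall x \near x0, psi x <= phi x.
  have : \forall x \near x0, eball c (d / 2) x.
    exact: (open_nbhs_nbhs (conj (open_eball c (d / 2)) Ox0)).
  apply: filterS2 touch => x h /h.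
  by rewrite phipsi subrr subr_ge0.
have along s : \forall t \near (0:R),
    psi (x0 + (s * t) *: v) <= phi (x0 + (s * t) *: v).
  have cl := continuous_line x0 (s *: v) 0.
  rewrite /continuous_at scale0r addr0 in cl.
  have near0 : \forall t \near (0:R),
    psi (x0 + t *: (s *: v)) <= phi (x0 + t *: (s *: v)) := cl _ below.
  by apply: filterS near0 => t; rewrite scalerA (mulrC t).
have := @hessian_cos_test _ _ psi x0 v (k * enorm v) (-1) psiC.
rewrite exprMn enorm_sqr -phipsi => test.
suff : 0 <= -1 * (dot (v *m hessian psi x0) v + k ^+ 2 * dot v v * phi x0) by lra.
apply: test.
have := near_cos_midpoint (x0 - c) v k k0 (kball _ Ox0).
apply: filterS3 (along 1) (along (-1)) => t.
rewrite mul1r mulN1r scaleNr /phi -/k -!(addrAC _ (- c)) => h1 h2 h3.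
lra.
Qed.

End lower_bound.

Theorem proposition3p5 (R : realType) (N : nat) (d : R) (c : 'rV[R]_N) :
  (0 < N)%N -> 0 < d ->
  [/\ open_bounded_convex (eball c (d / 2)),
      diam (eball c (d / 2)) = d &
      mu1 (eball c (d / 2)) =
        ereal_sup [set mu1 Omega | Omega in
          [set Omega : set 'rV[R]_N |
            open_bounded_convex Omega /\ diam Omega = d]]].
Proof.
move=> N0 d0.
have oB : open_bounded_convex (eball c (d / 2)).
  by split; [exact: open_eball|exact: bounded_eball|exact: convex_eball].
have dB : diam (eball c (d / 2)) = d.
  by rewrite diam_eball ?divr_gt0// mulrC divfK.
split=> //; apply/eqP; rewrite eq_le; apply/andP; split.
  by apply: ereal_sup_ubound; exists (eball c (d / 2)).
apply: (@le_trans _ _ ((pi / d) ^+ 2)%:E).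
  apply: ge_ereal_sup => _ [A [oA dA] <-].
  apply: ge_ereal_sup => _ [m [phi [lphi phi0 visc]] <-].
  by rewrite lee_fin; exact: (supersolution_le_diam A m d phi).
apply: ereal_sup_ubound; exists ((pi / d) ^+ 2) => //.
by exists (fun x => cos (pi / d * enorm (x - c))); exact: ball_supersolution.
Qed.
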